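(* Let $\beta>0$ and let $n\ge 2$ be an integer. Then $$f_{\beta,n}'(0)=-2n\,\frac{C_\beta(n)}{C_\beta(n-1)}\,\mathbb{E}_{Q\in G_{\beta,n-1}}\left\{|\det(Q)|^{\beta}\right\},$$ where $f_{\beta,n}'(0)=\lim_{\varepsilon\to 0^+}f_{\beta,n}'(\varepsilon)$ and $f_{\beta,n}(\varepsilon)$ is the probability that a random matrix from the ensemble $G_{\beta,n}$ has no eigenvalues in $(-\varepsilon,\varepsilon)$.
   Context: For $\beta>0$ and $n\ge 1$, the Gaussian $\beta$-ensemble $G_{\beta,n}$ has real eigenvalues $\lambda=(\lambda_1,\dots,\lambda_n)\in\mathbb{R}^n$ with joint probability density $$F_{\beta,n}(\lambda)=C_\beta(n)\exp\Big(-\frac{\beta}{2}\sum_{j=1}^n\lambda_j^2\Big)\prod_{1\le j<k\le n}|\lambda_k-\lambda_j|^{\beta},$$ $$C_\beta(n)=(2\pi)^{-n/2}\beta^{\,n(n-1)\beta/4+n/2}\prod_{j=1}^n\frac{\Gamma(1+\beta/2)}{\Gamma(1+j\beta/2)}.$$ (For $\beta=1,2,4$ these are the GOE, GUE and GSE.) The gap probability is, for $\varepsilon>0$, $$f_{\beta,n}(\varepsilon)=\int_{((-\infty,-\varepsilon)\cup(\varepsilon,+\infty))^n}F_{\beta,n}(\lambda)\,d\lambda .$$ The expectation of $|\det Q|^\beta$ over $G_{\beta,n-1}$ means $\int_{\mathbb{R}^{n-1}}|\lambda_1\cdots\lambda_{n-1}|^{\beta}F_{\beta,n-1}(\lambda)\,d\lambda$.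 *)

(* Defs.v *)
From HB Require Import structures.
From mathcomp Require Import all_boot all_order all_algebra.
From mathcomp Require Import all_classical all_reals all_analysis.

Set Implicit Arguments.
Unset Strict Implicit.
Unset Printing Implicit Defensive.

Import Order.TTheory GRing.Theory Num.Theory.
Import numFieldNormedType.Exports.

Local Open Scope classical_set_scope.
Local Open Scope ring_scope.

Section tuple_of_pair.
Context d (T : measurableType d) (n : nat).

Definition tuple_of_pair (x : T * n.-tuple T) : n.+1.-tuple T :=
  [tuple of x.1 :: x.2].

Definition pair_of_tuple (t : n.+1.-tuple T) : T * n.-tuple T :=
  (thead t, [tuple of behead t]).

Lemma tuple_of_pairK : cancel tuple_of_pair pair_of_tuple.
Proof. by case=> x t; congr pair; exact: val_inj. Qed.

Lemma pair_of_tupleK : cancel pair_of_tuple tuple_of_pair.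
Proof. by move=> t; rewrite [RHS]tuple_eta. Qed.

Lemma measurable_tuple_of_pair : measurable_fun [set: _] tuple_of_pair.
Proof. exact: measurable_cons. Qed.

Lemma measurable_pair_of_tuple : measurable_fun [set: _] pair_of_tuple.
Proof.
apply/measurable_fun_pairP; split; last exact: measurable_behead.
exact: (@measurable_tnth _ _ _ ord0).
Qed.

End tuple_of_pair.

Section cons_measure.
Context d (T : measurableType d) (R : realType) (n : nat).
Variable m : {sigma_finite_measure set T -> \bar R}.
Variable mu : {sigma_finite_measure set (n.-tuple T) -> \bar R}.

Definition cons_measure : set (n.+1.-tuple T) -> \bar R :=
  pushforward (m \x mu)%E (@tuple_of_pair _ T n).

Let mcons := @measurable_tuple_of_pair _ T n.

Let cons_measure0 : cons_measure set0 = 0%E.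
Proof. exact: measure0. Qed.

Let cons_measure_ge0 A : (0 <= cons_measure A)%E.
Proof. exact: measure_ge0. Qed.

Let cons_measure_sigma_additive : semi_sigma_additive cons_measure.
Proof. exact: measure_semi_sigma_additive. Qed.

HB.instance Definition _ := isMeasure.Build _ _ _ cons_measure
  cons_measure0 cons_measure_ge0 cons_measure_sigma_additive.

Let sigma_finite_cons_measure : sigma_finite setT cons_measure.
Proof.
have /sigma_finiteP[F [TF ndF Foo]] := sigma_finiteT m.
have /sigma_finiteP[G [TG ndG Goo]] := sigma_finiteT mu.
exists (fun k => @pair_of_tuple _ T n @^-1` (F k `*` G k)).
  rewrite -preimage_bigcup (_ : \bigcup_k _ = setT) ?preimage_setT//.
  apply/seteqP; split => // -[x t] _.
  have [i _ Fix] : (\bigcup_k F k) x by rewrite -TF.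
  have [j _ Gjt] : (\bigcup_k G k) t by rewrite -TG.
  exists (maxn i j) => //; split => /=.
  - by move: x Fix; exact/subsetPset/ndF/leq_maxl.
  - by move: t Gjt; exact/subsetPset/ndG/leq_maxr.
move=> k; have [mF mFoo] := Foo k; have [mG mGoo] := Goo k; split.
  rewrite -[X in measurable X]setTI; apply: measurable_pair_of_tuple => //.
  exact: measurableX.
rewrite /cons_measure /pushforward -comp_preimage.
rewrite (_ : _ \o _ = id) ?preimage_id; last first.
  by apply/funext => x /=; exact: tuple_of_pairK.
by rewrite product_measure1E// lte_mul_pinfty// ge0_fin_numE.
Qed.

HB.instance Definition _ :=
  Measure_isSigmaFinite.Build _ _ _ cons_measure sigma_finite_cons_measure.

End cons_measure.

Section tuple_measure.
Context d (T : measurableType d) (R : realType).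
Variable m : {sigma_finite_measure set T -> \bar R}.

(* The n-fold product measure m^n; T^0 is a single point of mass 1. *)
Fixpoint tuple_measure n : {sigma_finite_measure set (n.-tuple T) -> \bar R} :=
  match n with
  | 0 => \d_([tuple] : 0.-tuple T)
  | k.+1 => cons_measure m (tuple_measure k)
  end.

Lemma tuple_measure_box n (A : 'I_n -> set T) : (forall i, measurable (A i)) ->
  tuple_measure n [set t | forall i, A i (tnth t i)] =
  (\prod_(i < n) m (A i))%E.
Proof.
elim: n A => [|n ih] A mA /=.
  by rewrite big_ord0 diracE mem_set//= => -[].
rewrite big_ord_recl /cons_measure /pushforward /=.
rewrite (_ : _ @^-1` _ =
    A ord0 `*` [set t : n.-tuple T | forall i, A (lift ord0 i) (tnth t i)]).
  rewrite product_measure1E//; last first.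
    rewrite (_ : [set _ | _] =
      \bigcap_(i in [set: 'I_n]) ((@tnth n T ^~ i) @^-1` A (lift ord0 i))).
      apply: fin_bigcap_measurable; first exact: finite_finset.
      by move=> i _; rewrite -[X in measurable X]setTI; exact: measurable_tnth.
    by apply/seteqP; split => t /= h i; [move=> _; exact: h|exact: h].
  by congr (_ * _)%E; exact: ih.
apply/seteqP; split => -[x t] /=.
  move=> h; split=> [|i]; first exact: (h ord0).
  by have := h (lift ord0 i); rewrite tnthS.
by move=> [h0 h] i; case: (unliftP ord0 i) => [j|] ->; rewrite ?tnthS//.
Qed.

End tuple_measure.

Section beta_ensemble.
Context {R : realType}.
Implicit Types (beta x e : R) (n : nat).
Local Notation RM := (measurableTypeR R).
Local Notation leb := (@lebesgue_measure R).

(* Euler's Gamma integral; only used at arguments x > 1. *)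
Definition Gamma_fun x : R :=
  \int[leb]_(t in `]0, +oo[) (t `^ (x - 1) * expR (- t)).

Definition beta_const beta n : R :=
  (2 * pi) `^ (- (n%:R / 2)) *
  beta `^ (n%:R * (n%:R - 1) * beta / 4 + n%:R / 2) *
  \prod_(1 <= j < n.+1)
     (Gamma_fun (1 + beta / 2) / Gamma_fun (1 + j%:R * beta / 2)).

Definition beta_density beta n (l : n.-tuple RM) : R :=
  beta_const beta n *
  expR (- (beta / 2 * \sum_(j < n) tnth l j ^+ 2)) *
  \prod_(j < n) \prod_(k < n | (j < k)%N) `|tnth l k - tnth l j| `^ beta.

(* For beta > 0 the real-valued integrals below are the usual ones: the
   integrands are nonnegative and have a finite integral. *)
Definition gap_probability beta n e : R :=
  \int[tuple_measure leb n]_(l in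
      [set l : n.-tuple RM | forall i, tnth l i < - e \/ e < tnth l i])
    beta_density beta l.

Definition expect_absdet_powR beta n : R :=
  \int[tuple_measure leb n]_(l in [set: n.-tuple RM])
    (`|\prod_(i < n) tnth l i| `^ beta * beta_density beta l).

End beta_ensemble.

(* Main.v *)
(* Write the joint density, up to its constant, as a symmetric weight W on
   R^(n+1), and let K(x, c) be the integral of W(x, l) over those l in R^n all of
   whose entries lie outside [-c, c].  For 0 <= a <= b, pointwise comparison of
   indicators traps the drop of the integral of W over {all |l_i| > c} between
   c = a and c = b: by Tonelli and the symmetry of W it is at least (n+1) times
   the integral of K(x, b) over a < |x| <= b, and at most the same expression
   with K(x, a).  A Gaussian majorant of W and dominated convergence make K
   continuous on R^2, so the derivative at e > 0 is -(n+1)(K(e, e) + K(-e, e)),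
   which tends to -2(n+1) K(0, 0) as e -> 0+.  Finally W(0, l) is
   |l_1 ... l_n|^beta times the weight of the ensemble with n eigenvalues. *)
Require Import Defs.
From mathcomp Require Import all_boot all_order all_algebra.
From mathcomp Require Import all_classical all_reals all_analysis.
From mathcomp Require Import measurable_realfun ring lra.

Set Implicit Arguments.
Unset Strict Implicit.
Unset Printing Implicit Defensive.

Import Order.TTheory GRing.Theory Num.Theory.
Import numFieldNormedType.Exports.
Local Open Scope classical_set_scope.
Local Open Scope ring_scope.

(** * Inserting a coordinate at any position, and Tonelli for it *)

Section insert_tuple.
Context (T : Type) (n : nat).

(** Any entry can thus be singled out as the outer variable of an iterated integral; [unlift i j] is
    [None] exactly at [j = i]. *)
Definition insert_tuple (i : 'I_n.+1) (x : T) (l : n.-tuple T) : n.+1.-tuple T :=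
  [tuple if unlift i j is Some k then tnth l k else x | j < n.+1].

Lemma tnth_insert_tuple i x l : tnth (insert_tuple i x l) i = x.
Proof. by rewrite tnth_mktuple unlift_none. Qed.

Lemma tnth_insert_tuple_lift i x l j :
  tnth (insert_tuple i x l) (lift i j) = tnth l j.
Proof. by rewrite tnth_mktuple liftK. Qed.

Lemma insert_tuple0 x l : insert_tuple ord0 x l = [tuple of x :: l].
Proof.
apply: eq_from_tnth => j; have [k ->|->] := unliftP ord0 j.
  by rewrite tnth_insert_tuple_lift tnthS.
by rewrite tnth_insert_tuple tnth0.
Qed.

End insert_tuple.

(** Insertion beyond the head leaves the head alone; this drives the induction on the length in
    [ge0_integral_tuple_insert]. *)
Lemma insert_tuple_cons (T : Type) n (i : 'I_n.+1) (x y : T) (l : n.-tuple T) :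
  insert_tuple (lift ord0 i) x [tuple of y :: l] =
  [tuple of y :: insert_tuple i x l].
Proof.
apply: eq_from_tnth => j.
have [k ->|->] := unliftP (lift ord0 i) j; last first.
  by rewrite tnthS !tnth_insert_tuple.
rewrite tnth_insert_tuple_lift; have [p ->|->] := unliftP ord0 k.
  rewrite tnthS (_ : lift _ _ = lift ord0 (lift i p)); last first.
    by apply: val_inj; rewrite /= /bump !add1n ltnS !addnS.
  by rewrite tnthS tnth_insert_tuple_lift.
rewrite tnth0 (_ : lift _ _ = ord0) ?tnth0//.
exact: val_inj.
Qed.

Section insertion_fubini.
Context d (T : measurableType d) (R : realType).
Variable m : {sigma_finite_measure set T -> \bar R}.

Lemma measurable_insert_tuple n (i : 'I_n.+1) :
  measurable_fun [set: T * n.-tuple T] (fun z => insert_tuple i z.1 z.2).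
Proof.
apply/measurable_fun_tnthP => j.
have [k ->|->] := unliftP i j.
  rewrite (_ : _ \o _ = (@tnth _ T ^~ k) \o snd).
    by apply: measurableT_comp => //; exact: measurable_tnth.
  by apply/funext => z /=; rewrite tnth_insert_tuple_lift.
rewrite (_ : _ \o _ = fst)//.
by apply/funext => z /=; rewrite tnth_insert_tuple.
Qed.

Lemma measurable_insert_tuple_r n (i : 'I_n.+1) x :
  measurable_fun [set: n.-tuple T] (insert_tuple i x).
Proof.
apply: (@measurableT_comp _ _ _ _ _ _
  (fun z : T * n.-tuple T => insert_tuple i z.1 z.2) _ (pair x)).
  exact: measurable_insert_tuple.
exact: pair1_measurable.
Qed.

(** [tuple_measure] at [n.+1] is the image of a product measure, so this is Tonelli after a change
    of variables. *)
Lemma ge0_integral_tuple_cons n (phi : n.+1.-tuple T -> \bar R) :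
  measurable_fun setT phi -> (forall l, 0 <= phi l)%E ->
  (\int[tuple_measure m n.+1]_l phi l =
   \int[m]_x \int[tuple_measure m n]_l phi [tuple of x :: l])%E.
Proof.
move=> mphi phi0 /=; rewrite /cons_measure.
have mt := @measurable_tuple_of_pair _ T n.
rewrite ge0_integral_pushforward//= preimage_setT.
rewrite fubini_tonelli1//; exact: measurableT_comp.
Qed.

(** Peel off the head, insert into the tail by induction, then swap the two outer variables. *)
Lemma ge0_integral_tuple_insert n (i : 'I_n.+1) (phi : n.+1.-tuple T -> \bar R) :
  measurable_fun setT phi -> (forall l, 0 <= phi l)%E ->
  (\int[tuple_measure m n.+1]_l phi l =
   \int[m]_x \int[tuple_measure m n]_l phi (insert_tuple i x l))%E.
Proof.
elim: n i phi => [|n ih] i phi mphi phi0.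
  rewrite ge0_integral_tuple_cons//; apply: eq_integral => x _.
  by apply: eq_integral => l _; rewrite (ord1 i) insert_tuple0.
have [j ->|->] := unliftP ord0 i; last first.
  rewrite ge0_integral_tuple_cons//; apply: eq_integral => x _.
  by apply: eq_integral => l _; rewrite insert_tuple0.
rewrite ge0_integral_tuple_cons//.
pose psi (z : T * (T * n.-tuple T)) : \bar R :=
  phi [tuple of z.1 :: insert_tuple j z.2.1 z.2.2].
have mpsi : measurable_fun setT psi.
  apply: measurableT_comp => //; apply: measurable_cons => //.
  apply: (@measurableT_comp _ _ _ _ _ _ (fun z => insert_tuple j z.1 z.2)) => //.
  exact: measurable_insert_tuple.
have E1 y : (\int[tuple_measure m n.+1]_l phi [tuple of y :: l] =
    \int[m]_x \int[tuple_measure m n]_l psi (y, (x, l)))%E.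
  rewrite (ih j)//.
  by apply: measurableT_comp => //; exact: measurable_cons.
under eq_integral do rewrite E1.
(* Integrating out the remaining entries leaves a function of the head and the inserted value, to
   which two-variable Tonelli applies. *)
pose F (z : T * T) := (\int[tuple_measure m n]_l psi (z.1, (z.2, l)))%E.
have mF : measurable_fun setT F.
  apply: (@measurable_fun_fubini_tonelli_F _ _ _ _ R (tuple_measure m n)
     (fun z : (T * T) * n.-tuple T => psi (z.1.1, (z.1.2, z.2)))); last by move=> z; exact: phi0.
  apply: measurableT_comp => //.
  have m1 := measurable_fst : measurable_fun [set: (T * T) * n.-tuple T] fst.
  apply/measurable_fun_pairP; split => /=.
    exact: (measurableT_comp measurable_fst m1).
  apply/measurable_fun_pairP; split => /=; last exact: measurable_snd.
  exact: (measurableT_comp measurable_snd m1).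
transitivity (\int[m]_x \int[m]_y F (x, y))%E => //.
rewrite (@fubini_tonelli _ _ _ _ R m m F)//; last first.
  by move=> z; apply: integral_ge0 => l _; exact: phi0.
apply: eq_integral => x _ /=.
rewrite ge0_integral_tuple_cons//.
- apply: eq_integral => y _; apply: eq_integral => l _.
  by rewrite insert_tuple_cons.
- by apply: measurableT_comp => //; exact: measurable_insert_tuple_r.
Qed.

End insertion_fubini.

(** * The unnormalised density: symmetry and a Gaussian majorant *)

Section weight.
Context {R : realType}.
Variable beta : R.
Hypothesis beta_gt0 : 0 < beta.
Local Notation RM := (measurableTypeR R).

Definition vandermonde_powR n (l : n.-tuple RM) : R :=
  \prod_(j < n) \prod_(k < n | (j < k)%N) `|tnth l k - tnth l j| `^ beta.

Definition beta_weight n (l : n.-tuple RM) : R :=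
  expR (- (beta / 2 * \sum_(j < n) tnth l j ^+ 2)) * vandermonde_powR l.

Definition beta_slice n (x : R) (l : n.-tuple RM) : R :=
  expR (- (beta / 2 * x ^+ 2)) * (\prod_(j < n) `|x - tnth l j| `^ beta) *
  beta_weight l.

Lemma beta_densityE n (l : n.-tuple RM) :
  beta_density beta l = beta_const beta n * beta_weight l.
Proof. by rewrite /beta_density mulrA. Qed.

Lemma vandermonde_powR_insert n (i : 'I_n.+1) x (l : n.-tuple RM) :
  vandermonde_powR (insert_tuple i x l) =
  (\prod_(j < n) `|x - tnth l j| `^ beta) * vandermonde_powR l.
Proof.
rewrite /vandermonde_powR (bigD1_ord i)//=.
under [X in _ * X]eq_bigr => j _ do
  rewrite big_mkcond (bigD1_ord i)//= tnth_insert_tuple -big_mkcond/=.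
rewrite big_split/= mulrA; congr (_ * _); last first.
  apply: eq_bigr => j _; apply: eq_big => [k|k _].
    by rewrite /= !ltnNge leq_bump2.
  by rewrite !tnth_insert_tuple_lift.
(* Only the pairs containing [i] are left. Exactly one of [lift i j < i] and [i < lift i j] holds,
   so each [j] contributes one factor. *)
rewrite big_mkcond (bigD1_ord i)//= ltnn mul1r -big_split/=.
apply: eq_bigr => j _; rewrite tnth_insert_tuple !tnth_insert_tuple_lift.
have : lift i j != i by rewrite eq_sym neq_lift.
rewrite -(inj_eq val_inj)/= neq_ltn => /orP[ji|ij].
  by rewrite ji ltnNge (ltnW ji)/= mul1r.
by rewrite ij ltnNge (ltnW ij)/= mulr1 distrC.
Qed.

(** The right-hand side does not mention [i]: this is the symmetry of the weight in the form used
    below. *)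
Lemma beta_weight_insert n (i : 'I_n.+1) x (l : n.-tuple RM) :
  beta_weight (insert_tuple i x l) = beta_slice x l.
Proof.
rewrite /beta_weight /beta_slice /beta_weight vandermonde_powR_insert (bigD1_ord i)//=.
rewrite tnth_insert_tuple.
under eq_bigr do rewrite tnth_insert_tuple_lift.
by rewrite mulrDr opprD expRD mulrACA !mulrA.
Qed.

Lemma beta_slice0 n (l : n.-tuple RM) :
  beta_slice 0 l = `|\prod_(j < n) tnth l j| `^ beta * beta_weight l.
Proof.
rewrite /beta_slice expr0n/= mulr0 oppr0 expR0 mul1r; congr (_ * _).
under eq_bigr do rewrite sub0r normrN.
rewrite normr_prod.
(* Nonnegativity of the base is carried along, because [powRM] asks for it at every factor. *)
pose K (a b : R) := 0 <= b /\ a = b `^ beta.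
suff [] : K (\prod_(j < n) `|tnth l j| `^ beta) (\prod_(j < n) `|tnth l j|) by [].
elim/big_rec2: _ => [|j a b _ [b0 ->]]; first by rewrite /K powR1.
by split; rewrite ?mulr_ge0// powRM.
Qed.

Lemma vandermonde_powR_ge0 n (l : n.-tuple RM) : 0 <= vandermonde_powR l.
Proof. by apply: prodr_ge0 => j _; apply: prodr_ge0 => k _; exact: powR_ge0. Qed.

Lemma beta_weight_ge0 n (l : n.-tuple RM) : 0 <= beta_weight l.
Proof. by rewrite mulr_ge0 ?expR_ge0 ?vandermonde_powR_ge0. Qed.

Lemma beta_slice_ge0 n x (l : n.-tuple RM) : 0 <= beta_slice x l.
Proof. by rewrite -(beta_weight_insert ord0) beta_weight_ge0. Qed.

Lemma measurable_vandermonde_powR n :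
  measurable_fun [set: n.-tuple RM] (@vandermonde_powR n).
Proof.
apply: measurable_prod => j _.
rewrite (_ : (fun l : n.-tuple RM => _) = (fun l : n.-tuple RM =>
    \prod_(k <- [seq k : 'I_n <- index_enum _ | (j < k)%N])
     `|tnth l k - tnth l j| `^ beta)); last first.
  by apply/funext => l; rewrite big_filter.
apply: measurable_prod => k _.
apply: (measurableT_comp (measurable_powR beta)).
apply: measurableT_comp => //.
by apply: measurable_funB; exact: measurable_tnth.
Qed.

Lemma measurable_beta_weight n :
  measurable_fun [set: n.-tuple RM] (@beta_weight n).
Proof.
apply: measurable_funM; last exact: measurable_vandermonde_powR.
apply: measurableT_comp => //; apply: measurableT_comp => //.
apply: measurable_funM => //; apply: measurable_sum => j.
by apply: measurable_funX; exact: measurable_tnth.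
Qed.

Lemma measurable_beta_slice n x :
  measurable_fun [set: n.-tuple RM] (beta_slice x).
Proof.
rewrite (_ : beta_slice x = @beta_weight n.+1 \o insert_tuple ord0 x).
  apply: measurableT_comp; first exact: measurable_beta_weight.
  exact: measurable_insert_tuple_r.
by apply/funext => l /=; rewrite beta_weight_insert.
Qed.

(** The rate [beta / 4] is half of that in the weight; the other half absorbs the Vandermonde
    factor. *)
Definition gauss_dom n (l : n.-tuple RM) : R :=
  \prod_(j < n) expR (- (beta / 4 * tnth l j ^+ 2)).

Lemma gauss_dom_ge0 n (l : n.-tuple RM) : 0 <= gauss_dom l.
Proof. by apply: prodr_ge0 => j _; exact: expR_ge0. Qed.

(** From [|x - y| <= |x| + |y| <= exp (|x| + |y|)]; with exponentials the product over pairs becomes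
    a sum of exponents. *)
Lemma powR_dist_le (x y : R) :
  `|x - y| `^ beta <= expR ((`|x| + `|y|) * beta).
Proof.
rewrite expRM ge0_ler_powR ?nnegrE ?expR_ge0 ?(ltW beta_gt0)//.
apply: (le_trans (ler_normB _ _)); apply: le_trans (expR_ge1Dx _).
by rewrite lerDr.
Qed.

(** Passing from the pairs [j < k] to all ordered pairs only adds factors that are at least 1. *)
Lemma vandermonde_powR_le n (l : n.-tuple RM) :
  vandermonde_powR l <=
  \prod_(j < n) \prod_(k < n) expR ((`|tnth l k| + `|tnth l j|) * beta).
Proof.
apply: ler_prod => j _; apply/andP; split.
  by apply: prodr_ge0 => k _; exact: powR_ge0.
rewrite big_mkcond; apply: ler_prod => k _; apply/andP; split.
  by case: ifP => // _; exact: powR_ge0.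
case: ifP => _; first exact: powR_dist_le.
by rewrite -expR0 ler_expR mulr_ge0 ?addr_ge0// ltW.
Qed.

(** [4 n^2 beta] is what completing the square leaves per coordinate; the product form lets it merge
    with the exponent of [gauss_dom]. *)
Definition weight_bound n : R := \prod_(j < n) expR (4 * n%:R ^+ 2 * beta).

Lemma weight_bound_ge0 n : 0 <= weight_bound n.
Proof. by apply: prodr_ge0 => j _; exact: expR_ge0. Qed.

Lemma beta_weight_le n (l : n.-tuple RM) :
  beta_weight l <= weight_bound n * gauss_dom l.
Proof.
apply: (le_trans (ler_wpM2l (expR_ge0 _) (vandermonde_powR_le l))).
rewrite /weight_bound /gauss_dom -!expR_sum.
under [X in _ * X]eq_bigr do rewrite -expR_sum.
rewrite -expR_sum -!expRD ler_expR mulr_sumr -sumrN.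
have -> : \sum_(j < n) \sum_(k < n) (`|tnth l k| + `|tnth l j|) * beta =
    \sum_(j < n) 2 * n%:R * beta * `|tnth l j|.
  under eq_bigr do rewrite -mulr_suml big_split/= sumr_const card_ord.
  rewrite -mulr_suml big_split/= sumr_const card_ord -mulr_sumr.
  by rewrite sumrMnl -mulr_natr; ring.
rewrite -!big_split/=; apply: ler_sum => j _.
(* completing the square: [2 n |t| <= t^2 / 4 + 4 n^2] *)
rewrite -(real_normK (num_real (tnth l j))).
have := mulr_ge0 (ltW beta_gt0) (sqr_ge0 (`|tnth l j| - 4 * n%:R)).
move: (`|_|) (n%:R) => a b.
nra.
Qed.

(** The bound is uniform in [x], as dominated convergence with a moving [x] requires: the Gaussian
    factor of the inserted [x] is at most 1. *)
Lemma beta_slice_le n x (l : n.-tuple RM) :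
  beta_slice x l <= weight_bound n.+1 * gauss_dom l.
Proof.
rewrite -(beta_weight_insert ord0); apply: (le_trans (beta_weight_le _)).
rewrite ler_wpM2l ?weight_bound_ge0// /gauss_dom big_ord_recl.
under eq_bigr do rewrite tnth_insert_tuple_lift.
rewrite ler_piMl ?gauss_dom_ge0// -expR0 ler_expR oppr_le0 mulr_ge0 ?sqr_ge0//.
by rewrite divr_ge0// ltW.
Qed.

End weight.

Lemma continuous_powR_norm (R : realType) (p : R) : 0 < p ->
  continuous (fun x : R => `|x| `^ p).
Proof.
move=> p0 x; have [->|x0] := eqVneq x 0.
  rewrite /continuous_at normr0 powR0 ?gt_eqF//.
  apply/cvgr0Pnorm_lt => e e0; near=> y.
  rewrite ger0_norm ?powR_ge0//.
  (* Writing [e] as the [p]-th power of [e^(1/p)] reduces the claim to [|y| < e^(1/p)]. *)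
  rewrite -[ltRHS]powRr1 ?(ltW e0)// -(@mulVf _ p) ?gt_eqF// powRrM.
  rewrite gt0_ltr_powR ?nnegrE ?powR_ge0//.
near: y; exists (e `^ p^-1); first by rewrite /= powR_gt0.
  by move=> z; rewrite /= sub0r normrN.
apply: (@continuous_comp _ _ _ (fun y : R => `|y|) (fun y => y `^ p)).
  exact: norm_continuous.
apply: differentiable_continuous; apply/derivable1_diffP.
by apply: derivable_powR; rewrite in_itv/= andbT normr_gt0.
Unshelve. all: end_near. Qed.

(** * Continuity of the edge density by dominated convergence *)

Section edge_integral.
Context {R : realType}.
Variable beta : R.
Hypothesis beta_gt0 : 0 < beta.
Local Notation RM := (measurableTypeR R).
Local Notation leb := (@lebesgue_measure R).

Lemma integrable_gauss (c : R) : 0 < c ->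
  leb.-integrable [set: RM] (fun x => (expR (- (c * x ^+ 2)))%:E).
Proof.
(* The function is a multiple of the normal density with variance [1 / (2 c)]. *)
move=> c0; pose s := Num.sqrt (2 * c)^-1.
have s2 : s ^+ 2 = (2 * c)^-1 by rewrite sqr_sqrtr// invr_ge0 mulr_ge0// ltW.
have s0 : s != 0 by rewrite sqrtr_eq0 -ltNge invr_gt0 mulr_gt0.
have := integrableZl measurableT (normal_peak s)^-1 (integrable_normal_pdf 0 s).
apply: eq_integrable => // x _; rewrite -EFinM; congr EFin.
rewrite normal_pdfE// mulKf ?gt_eqF ?normal_peak_gt0//.
rewrite /normal_fun subr0 s2; congr expR.
have : c != 0 by rewrite gt_eqF.
rewrite -mulr_natr => ?; field.
by [].
Qed.

Lemma measurable_gauss_dom n :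
  measurable_fun [set: n.-tuple RM] (@gauss_dom R beta n).
Proof.
apply: measurable_prod => j _; apply: measurableT_comp => //.
apply: measurableT_comp => //; apply: measurable_funM => //.
by apply: measurable_funX; exact: measurable_tnth.
Qed.

(** Tonelli peels off one coordinate at a time, each giving the same finite one-dimensional Gaussian
    integral. *)
Lemma integrable_gauss_dom n :
  (tuple_measure leb n).-integrable setT (EFin \o @gauss_dom R beta n).
Proof.
apply/integrableP; split; first by apply/measurable_EFinP; exact: measurable_gauss_dom.
under eq_integral do rewrite /= ger0_norm ?gauss_dom_ge0//.
have c0 : 0 < beta / 4 by rewrite divr_gt0.
have ig : (\int[leb]_(x in [set: RM]) (expR (- (beta / 4 * x ^+ 2)))%:E < +oo)%E.
  have /integrableP[_] := integrable_gauss c0; congr (_ < _)%E.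
  by apply: eq_integral => x _; rewrite /= ger0_norm ?expR_ge0.
elim: n => [|n ih].
  rewrite integral_dirac//; last by apply/measurable_EFinP; exact: measurable_gauss_dom.
  by rewrite diracT mul1e ltry.
rewrite ge0_integral_tuple_cons; last 2 first.
- by apply/measurable_EFinP; exact: measurable_gauss_dom.
- by move=> l; rewrite lee_fin gauss_dom_ge0.
under eq_integral => x _.
  under eq_integral => l _.
    rewrite /gauss_dom big_ord_recl tnth0.
    under eq_bigr do rewrite tnthS.
    rewrite EFinM; over.
  rewrite ge0_integralZl_EFin ?expR_ge0//; last 2 first.
  - by move=> l _; rewrite lee_fin gauss_dom_ge0.
  - by apply/measurable_EFinP; exact: measurable_gauss_dom.
  over.
rewrite ge0_integralZr//.
- by rewrite lte_mul_pinfty ?ih ?ge0_fin_numE ?integral_ge0//.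
- exact: (measurable_int _ (integrable_gauss c0)).
- by apply: integral_ge0 => l _; rewrite lee_fin gauss_dom_ge0.
Qed.

(** As a function of [c], an indicator of [|tnth l i| > c] jumps only at [|tnth l i|]. For fixed [i]
    the exceptional set is a box with one side inside [{c, -c}], hence null. *)
Lemma tuple_measure_ae_neq n c :
  {ae tuple_measure leb n, forall l : n.-tuple RM, forall i, `|tnth l i| <> c}.
Proof.
apply: filter_forall => i.
pose A (j : 'I_n) : set RM := if j == i then [set x : RM | `|x| = c] else setT.
have sub : [set x : RM | `|x| = c] `<=` [set c; - c].
  move=> x /= <-; have [x0|x0] := ger0P x; first by left.
  by right; rewrite opprK.
have fin : finite_set [set x : RM | `|x| = c].
  by apply: sub_finite_set sub _; exact: finite_set2.
have m0 : measurable [set x : RM | `|x| = c] by exact: countable_measurable (finite_set_countable fin).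
have mA j : measurable (A j) by rewrite /A; case: ifP.
exists [set l : n.-tuple RM | forall j, A j (tnth l j)]; split.
- rewrite (_ : [set _ | _] =
      \bigcap_(j in [set: 'I_n]) ((@tnth n RM ^~ j) @^-1` A j)).
    apply: fin_bigcap_measurable; first exact: finite_finset.
    by move=> j _; rewrite -[X in measurable X]setTI; exact: measurable_tnth.
  by apply/seteqP; split => l /= h j; [move=> _; exact: h|exact: h].
- rewrite tuple_measure_box// (bigD1 i)//= {1}/A eqxx.
  by rewrite countable_lebesgue_measure0 ?mul0e//; exact: finite_set_countable.
- move=> l /= /contrapT li j; rewrite /A; case: ifP => // /eqP ->.
  exact: li.
Qed.

(** Real-valued indicators turn the event on all entries into a product, from which one factor can
    be split off. *)
Definition outside (c x : R) : R := (c < `|x|)%R%:R.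

Definition all_outside n c (l : n.-tuple RM) : R :=
  \prod_(i < n) outside c (tnth l i).

Lemma all_outside_ge0 n c (l : n.-tuple RM) : 0 <= all_outside c l.
Proof. by apply: prodr_ge0 => i _; exact: ler0n. Qed.

Lemma all_outside_le1 n c (l : n.-tuple RM) : all_outside c l <= 1.
Proof. by apply: Num.Theory.prodr_ile1 => i _; rewrite ler0n lern1 leq_b1. Qed.

Lemma measurable_outside c : measurable_fun [set: RM] (outside c).
Proof.
rewrite (_ : outside c = \1_[set x : RM | c < `|x|]).
  apply: measurable_indic.
  rewrite (_ : [set x | _] = (fun x : RM => `|x|) @^-1` `]c, +oo[).
    rewrite -[X in measurable X]setTI.
    exact: (normr_measurable measurableT (measurable_itv `]c, +oo[)).
  by apply/seteqP; split => x /=; rewrite in_itv/= andbT.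
apply/funext => x; rewrite /outside indicE; congr ((nat_of_bool _)%:R).
by apply/idP/idP; rewrite inE.
Qed.

Lemma measurable_all_outside n c :
  measurable_fun [set: n.-tuple RM] (@all_outside n c).
Proof.
apply: measurable_prod => i _.
apply: (measurableT_comp (measurable_outside c)); exact: measurable_tnth.
Qed.

(* Up to the normalising constant, the density of one eigenvalue at x together
   with the event that all the others lie outside [-c, c]. *)
Definition edge_density n (x c : R) : R :=
  \int[tuple_measure leb n]_l (beta_slice beta x l * all_outside c l).

Lemma measurable_edge_integrand n x c : measurable_fun [set: n.-tuple RM]
  (fun l => (beta_slice beta x l * all_outside c l)%:E).
Proof.
apply/measurable_EFinP; apply: measurable_funM.
  exact: measurable_beta_slice.
exact: measurable_all_outside.
Qed.

Lemma edge_integrand_ge0 n x c (l : n.-tuple RM) :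
  0 <= beta_slice beta x l * all_outside c l.
Proof. by rewrite mulr_ge0 ?beta_slice_ge0 ?all_outside_ge0. Qed.

Lemma edge_integrand_le n x c (l : n.-tuple RM) :
  beta_slice beta x l * all_outside c l <=
  weight_bound beta n.+1 * gauss_dom beta l.
Proof.
apply: le_trans (beta_slice_le beta_gt0 x l).
by rewrite ler_piMr ?beta_slice_ge0 ?all_outside_le1.
Qed.

Lemma integrable_edge_integrand n x c :
  (tuple_measure leb n).-integrable setT
    (fun l => (beta_slice beta x l * all_outside c l)%:E).
Proof.
have := integrableZl measurableT (weight_bound beta n.+1) (integrable_gauss_dom n).
apply: le_integrable => //; first exact: measurable_edge_integrand.
move=> l _; rewrite -EFinM lee_fin ger0_norm ?edge_integrand_ge0//.
rewrite (le_trans (edge_integrand_le _ _ _))// ler_norm//.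
Qed.

Lemma edge_densityE n x c :
  (\int[tuple_measure leb n]_l (beta_slice beta x l * all_outside c l)%:E)%E =
  (edge_density n x c)%:E.
Proof.
rewrite /edge_density /Rintegral fineK//; apply: integrable_fin_num => //.
exact: integrable_edge_integrand.
Qed.

(** The indicator is locally constant in [c] away from [|x|]. *)
Lemma outside_cvg (c0 x : R) (c : R^nat) : c @ \oo --> c0 -> `|x| <> c0 ->
  outside (c k) x @[k --> \oo] --> outside c0 x.
Proof.
move=> cc0 /eqP; rewrite neq_lt => /orP[xc|cx]; apply: cvg_near_cst; near=> k.
  rewrite /outside !ltNge (ltW xc)/=.
  suff -> : `|x| <= c k by [].
  by apply/ltW; near: k; exact: (cvgr_gt _ cc0).
rewrite /outside cx; suff -> : c k < `|x| by [].
by near: k; exact: (cvgr_lt _ cc0).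
Unshelve. all: end_near. Qed.

Lemma beta_slice_cvg n (l : n.-tuple RM) (x0 : R) (x : R^nat) : x @ \oo --> x0 ->
  beta_slice beta (x k) l @[k --> \oo] --> beta_slice beta x0 l.
Proof.
move=> xx0; apply: cvgM; last exact: cvg_cst.
apply: cvgM.
  apply: (cvg_comp _ expR); last exact: continuous_expR.
  by apply: cvgN; apply: cvgM; [exact: cvg_cst|exact: cvgM].
apply: cvg_big => [|j _]; first exact: mul_continuous.
apply: (cvg_comp _ (fun y : R => `|y| `^ beta)); last first.
  exact: continuous_powR_norm.
by apply: cvgB => //; exact: cvg_cst.
Qed.

(** The majorant depends on neither [x] nor [c], and pointwise convergence can fail only where some
    [|tnth l i| = c0], a null set. *)
Lemma edge_density_cvg n (x0 c0 : R) (x c : R^nat) :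
  x @ \oo --> x0 -> c @ \oo --> c0 ->
  edge_density n (x k) (c k) @[k --> \oo] --> edge_density n x0 c0.
Proof.
move=> xx0 cc0.
pose f k (l : n.-tuple RM) := (beta_slice beta (x k) l * all_outside (c k) l)%:E.
pose f0 (l : n.-tuple RM) := (beta_slice beta x0 l * all_outside c0 l)%:E.
pose g (l : n.-tuple RM) := ((weight_bound beta n.+1)%:E * (gauss_dom beta l)%:E)%E.
have ff0 : {ae tuple_measure leb n, forall l, setT l -> f ^~ l @ \oo --> f0 l}.
  apply: filterS (tuple_measure_ae_neq n c0) => l lc _.
  apply: cvg_EFin; first exact: nearW.
  apply: cvgM; first exact: beta_slice_cvg.
  by apply: cvg_big => [|j _]; [exact: mul_continuous|exact: outside_cvg].
have fg : {ae tuple_measure leb n, forall l k, setT l -> (`|f k l| <= g l)%E}.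
  apply: aeW => l k _; rewrite /f /g -EFinM lee_fin ger0_norm ?edge_integrand_ge0//.
  exact: edge_integrand_le.
have ig : (tuple_measure leb n).-integrable setT g.
  exact: (integrableZl measurableT _ (integrable_gauss_dom n)).
have [_ _] := dominated_convergence measurableT
  (fun k => measurable_edge_integrand (x k) (c k))
  (measurable_edge_integrand x0 c0) ff0 ig fg.
rewrite edge_densityE; under eq_fun do rewrite edge_densityE.
exact: fine_cvg.
Qed.

Lemma edge_density_ge0 n x c : 0 <= edge_density n x c.
Proof. by apply: Rintegral_ge0 => l _; exact: edge_integrand_ge0. Qed.

(** Sequential continuity in epsilon-delta form: if no [d] worked, the radii [1 / (k + 1)] would
    yield a sequence tending to [(x0, c0)] whose values stay [e] away from the limit. *)
Lemma edge_density_near n (x0 c0 : R) (e : R) : 0 < e ->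
  exists2 d, 0 < d & forall x c, `|x - x0| < d -> `|c - c0| < d ->
    `|edge_density n x c - edge_density n x0 c0| < e.
Proof.
move=> e0; apply: contrapT => H.
have /choice[xc xcP] (k : nat) : exists xc : R * R,
    [/\ `|xc.1 - x0| < k.+1%:R^-1, `|xc.2 - c0| < k.+1%:R^-1 &
      e <= `|edge_density n xc.1 xc.2 - edge_density n x0 c0|].
  apply: contrapT => Hk; apply: H; exists k.+1%:R^-1 => [|x c xd cd].
    by rewrite invr_gt0.
  by rewrite ltNge; apply/negP => ?; apply: Hk; exists (x, c).
have cvg_inv (u : R^nat) (u0 : R) : (forall k, `|u k - u0| < k.+1%:R^-1) ->
    u @ \oo --> u0.
  move=> uP; apply/cvgrPdist_lt => d d0; near=> k.
  rewrite distrC (lt_trans (uP k))//; near: k.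
  have := @cvg_harmonic R; move=> /cvgr0Pnorm_lt /(_ _ d0).
  by apply: filterS => k /=; rewrite ger0_norm// invr_ge0.
have c1 : (fun k => (xc k).1) @ \oo --> x0.
  by apply: cvg_inv => k; have [] := xcP k.
have c2 : (fun k => (xc k).2) @ \oo --> c0.
  by apply: cvg_inv => k; have [] := xcP k.
have := edge_density_cvg (n := n) c1 c2.
move=> /cvgrPdist_lt /(_ _ e0)[N _ /(_ N (leqnn N))]/=.
by rewrite distrC ltNge; have [_ _ ->] := xcP N.
Unshelve. all: end_near. Qed.

End edge_integral.

(** * Comparison of products of nested indicators *)

Section prod_telescope.
Context {R : realDomainType}.
Variables (n : nat) (A B : 'I_n -> bool).
Hypothesis BA : forall i, B i -> A i.
Local Notation a i := ((A i)%:R : R).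
Local Notation b i := ((B i)%:R : R).

Let ab_ge0 i : 0 <= a i - b i.
Proof. by have := @BA i; case: (B i) (A i) => [] [] //=; rewrite ?subrr ?subr0// => /(_ isT). Qed.

Let prod_ge0 (P : pred 'I_n) (C : 'I_n -> bool) :
  0 <= \prod_(i | P i) (C i)%:R :> R.
Proof. by apply: prodr_ge0 => i _; exact: ler0n. Qed.

Let prod1 (C : 'I_n -> bool) (P : pred 'I_n) : (forall i, C i) ->
  \prod_(i | P i) (C i)%:R = 1 :> R.
Proof. by move=> C1; rewrite big1// => i _; rewrite C1. Qed.

Let prod0 (C : 'I_n -> bool) (P : pred 'I_n) i : P i -> ~~ C i ->
  \prod_(i | P i) (C i)%:R = 0 :> R.
Proof. by move=> Pi /negbTE Ci; rewrite (bigD1 i)//= Ci mul0r. Qed.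

(** If all [A i] hold but some [B i] fails, the term of that [i] alone equals 1 and the others are
    nonnegative. *)
Lemma prod_indic_le :
  \prod_i a i <= \prod_i b i + \sum_i (a i - b i) * \prod_(j | j != i) a j.
Proof.
have S0 (P : pred 'I_n) :
    0 <= \sum_(i | P i) (a i - b i) * \prod_(j | j != i) a j.
  by apply: sumr_ge0 => i _; rewrite mulr_ge0.
have [/forallP A1|/forallPn[i Ai]] := boolP [forall i, A i]; last first.
  by rewrite (prod0 _ Ai)// addr_ge0.
have [/forallP B1|/forallPn[i Bi]] := boolP [forall i, B i].
  by rewrite !prod1// lerDl.
rewrite (prod1 _ A1) (prod0 _ Bi)// add0r (bigD1 i)//=.
by rewrite (prod1 _ A1) A1 (negbTE Bi) subr0 mulr1 lerDl.
Qed.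

(** The events in the sum are disjoint: if all [A i] hold and [B i] fails, every term other than the
    one of [i] contains the factor [B i]. *)
Lemma prod_indic_ge :
  \prod_i b i + \sum_i (a i - b i) * \prod_(j | j != i) b j <= \prod_i a i.
Proof.
have [/forallP A1|/forallPn[i Ai]] := boolP [forall i, A i]; last first.
  have Bi : ~~ B i by apply: contra Ai; exact: BA.
  rewrite (prod0 _ Bi)// add0r big1// => j _.
  have [->|ji] := eqVneq j i; first by rewrite (negbTE Ai) (negbTE Bi) subrr mul0r.
  by rewrite (prod0 _ Bi) ?mulr0// eq_sym.
rewrite (prod1 _ A1).
have [/forallP B1|/forallPn[i Bi]] := boolP [forall i, B i].
  by rewrite (prod1 _ B1) big1 ?addr0// => i _; rewrite A1 B1 subrr mul0r.
rewrite (prod0 _ Bi)// add0r (bigD1 i)//= [X in _ + X]big1 => [|j ji].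
  rewrite addr0 A1 (negbTE Bi) subr0 mul1r.
  by apply: Num.Theory.prodr_ile1 => j _; rewrite ler0n lern1 leq_b1.
by rewrite (prod0 _ Bi) ?mulr0// eq_sym.
Qed.

End prod_telescope.

(** * Two-sided bounds for the decrease of the gap integral *)

Section gap_weight.
Context {R : realType}.
Variable beta : R.
Hypothesis beta_gt0 : 0 < beta.
Local Notation RM := (measurableTypeR R).
Local Notation leb := (@lebesgue_measure R).
Local Notation beta_weight := (beta_weight beta).
Local Notation edge_density := (edge_density beta).

Definition gap_weight n c : R :=
  \int[tuple_measure leb n]_l (beta_weight l * all_outside c l).

Lemma integrable_gap_integrand n c :
  (tuple_measure leb n).-integrable setT
    (fun l => (beta_weight l * all_outside c l)%:E).
Proof.
have := integrableZl measurableT (weight_bound beta n)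
  (integrable_gauss_dom beta_gt0 n).
apply: le_integrable => //.
  apply/measurable_EFinP; apply: measurable_funM.
    exact: measurable_beta_weight.
  exact: measurable_all_outside.
move=> l _; rewrite -EFinM lee_fin ger0_norm; last first.
  by rewrite mulr_ge0 ?beta_weight_ge0 ?all_outside_ge0.
apply: le_trans (ler_norm _); apply: le_trans (beta_weight_le beta_gt0 l).
by rewrite ler_piMr ?beta_weight_ge0 ?all_outside_le1.
Qed.

Lemma gap_weightE n c :
  (\int[tuple_measure leb n]_l (beta_weight l * all_outside c l)%:E)%E =
  (gap_weight n c)%:E.
Proof.
rewrite /gap_weight /Rintegral fineK//; apply: integrable_fin_num => //.
exact: integrable_gap_integrand.
Qed.

Lemma gap_probabilityE n c :
  gap_probability beta n c = beta_const beta n * gap_weight n c.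
Proof.
rewrite /gap_probability /gap_weight -RintegralZl//; last first.
  exact: integrable_gap_integrand.
rewrite Rintegral_mkcond; congr (fine _); apply: eq_integral => l _.
congr EFin; rewrite /patch beta_densityE /all_outside.
have outE i : (c < `|tnth l i|) <-> (tnth l i < - c \/ c < tnth l i).
  rewrite ltr_normr ltrNr; split=> [/orP[]|[]] ->; rewrite ?orbT//; [by right|by left].
case: ifPn => [|/negP] lS.
  rewrite big1 ?mulr1// => i _; rewrite /outside.
  by move: lS; rewrite inE => /(_ i)/outE ->.
have [i li] : exists i, ~~ (c < `|tnth l i|).
  apply: contrapT => H; apply: lS; rewrite inE /= => i.
  by apply/outE; apply: contrapT => /negP ?; apply: H; exists i.
by rewrite (bigD1 i)//= /outside (negbTE li) mul0r !mulr0.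
Qed.

(** The threshold [c] for the other entries stays free: it is [a] in the upper estimate and [b] in
    the lower one. *)
Definition shell_integrand n (i : 'I_n) (a b c : R) (l : n.-tuple RM) : R :=
  beta_weight l * ((outside a (tnth l i) - outside b (tnth l i)) *
                   \prod_(j | j != i) outside c (tnth l j)).

Lemma outside_anti (a b x : R) : a <= b -> 0 <= outside a x - outside b x.
Proof.
move=> ab; rewrite subr_ge0 /outside ler_nat.
by case: (ltP b) => // bx; rewrite (le_lt_trans ab bx).
Qed.

Lemma shell_integrand_ge0 n (i : 'I_n) (a b c : R) l : a <= b ->
  0 <= shell_integrand i a b c l.
Proof.
move=> ab; rewrite mulr_ge0 ?beta_weight_ge0// mulr_ge0 ?outside_anti//.
by apply: prodr_ge0 => j _; exact: ler0n.
Qed.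

Lemma measurable_shell_integrand n (i : 'I_n) (a b c : R) :
  measurable_fun [set: n.-tuple RM] (shell_integrand i a b c).
Proof.
have mo d j : measurable_fun [set: n.-tuple RM] (fun l => outside d (tnth l j)).
  by apply: (measurableT_comp (measurable_outside d)); exact: measurable_tnth.
apply: measurable_funM; first exact: measurable_beta_weight.
apply: measurable_funM; first exact: measurable_funB.
rewrite (_ : (fun l : n.-tuple RM => _) = (fun l : n.-tuple RM =>
    \prod_(j <- [seq j : 'I_n <- index_enum _ | j != i])
     outside c (tnth l j))); last first.
  by apply/funext => l; rewrite big_filter.
exact: measurable_prod.
Qed.

Lemma shell_integrand_insert n (i : 'I_n.+1) (a b c x : R) l :
  shell_integrand i a b c (insert_tuple i x l) =
  (outside a x - outside b x) * (beta_slice beta x l * all_outside c l).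
Proof.
rewrite /shell_integrand beta_weight_insert tnth_insert_tuple mulrCA.
congr (_ * (_ * _)); rewrite big_mkcond (bigD1_ord i)//= eqxx mul1r.
apply: eq_bigr => j _; rewrite tnth_insert_tuple_lift.
by rewrite eq_sym neq_lift.
Qed.

(** Kept in the extended reals, where nonnegativity and measurability justify every exchange of
    integrals. *)
Definition shell n (a b c : R) : \bar R :=
  \int[leb]_(x in [set: RM])
    ((outside a x - outside b x) * edge_density n x c)%:E.

(** Singling out entry [i] gives a value free of [i], by [beta_weight_insert]; the factor [n.+1]
    below comes from here. *)
Lemma integral_shell_integrand n (i : 'I_n.+1) (a b c : R) : a <= b ->
  (\int[tuple_measure leb n.+1]_l (shell_integrand i a b c l)%:E)%E =
  shell n a b c.
Proof.
move=> ab; rewrite (ge0_integral_tuple_insert _ i).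
- apply: eq_integral => x _.
  under eq_integral do rewrite shell_integrand_insert EFinM.
  rewrite ge0_integralZl_EFin ?outside_anti//.
  + by rewrite edge_densityE.
  + by move=> l _; rewrite lee_fin edge_integrand_ge0.
  + exact: measurable_edge_integrand.
- by apply/measurable_EFinP; exact: measurable_shell_integrand.
- by move=> l; rewrite lee_fin shell_integrand_ge0.
Qed.

(** Measurability in [x] comes from Tonelli: this is a partial integral of a jointly measurable
    nonnegative function. *)
Lemma measurable_shell n (a b c : R) : a <= b -> measurable_fun [set: RM]
  (fun x => ((outside a x - outside b x) * edge_density n x c)%:E).
Proof.
move=> ab.
pose F (z : RM * n.-tuple RM) : \bar R :=
  (shell_integrand ord0 a b c (insert_tuple ord0 z.1 z.2))%:E.
rewrite (_ : (fun x => _) = fubini_F (tuple_measure leb n) F).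
  apply: measurable_fun_fubini_tonelli_F => [|z]; last first.
    by rewrite lee_fin shell_integrand_ge0.
  apply/measurable_EFinP; apply: measurableT_comp.
    exact: measurable_shell_integrand.
  exact: measurable_insert_tuple.
apply/funext => x; rewrite /fubini_F /F /=.
under eq_integral do rewrite shell_integrand_insert EFinM.
rewrite ge0_integralZl_EFin ?outside_anti//.
- by rewrite edge_densityE.
- by move=> l _; rewrite lee_fin edge_integrand_ge0.
- exact: measurable_edge_integrand.
Qed.

Lemma sum_shell_integrand n (a b c : R) (l : n.-tuple RM) :
  beta_weight l * \sum_i (outside a (tnth l i) - outside b (tnth l i)) *
      \prod_(j | j != i) outside c (tnth l j) =
  \sum_i shell_integrand i a b c l.
Proof. by rewrite mulr_sumr. Qed.

Lemma integral_sum_shell_integrand n (a b c d : R) : a <= b ->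
  (\int[tuple_measure leb n.+1]_l
     ((beta_weight l * all_outside d l)%:E +
      \sum_(i < n.+1) (shell_integrand i a b c l)%:E))%E =
  ((gap_weight n.+1 d)%:E + shell n a b c *+ n.+1)%E.
Proof.
move=> ab; have ms (i : 'I_n.+1) : measurable_fun [set: n.+1.-tuple RM]
    (fun l => (shell_integrand i a b c l)%:E).
  by apply/measurable_EFinP; exact: measurable_shell_integrand.
have s0 (i : 'I_n.+1) (l : n.+1.-tuple RM) : setT l ->
    (0 <= (shell_integrand i a b c l)%:E)%E.
  by move=> _; rewrite lee_fin shell_integrand_ge0.
rewrite ge0_integralD//; last 4 first.
- by move=> l _; rewrite lee_fin mulr_ge0 ?beta_weight_ge0 ?all_outside_ge0.
- exact: measurable_int (integrable_gap_integrand _ _).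
- by move=> l _; apply: sume_ge0 => i _; exact: s0.
- exact: emeasurable_sum.
rewrite gap_weightE ge0_integral_sum//; congr (_ + _)%E.
under eq_bigr do rewrite integral_shell_integrand//.
by rewrite sumr_const card_ord.
Qed.

(** Tuples lost between [a] and [b] have some entry in the shell and the others outside [[-a, a]];
    [prod_indic_le] counts each at least once. *)
Lemma gap_weight_le_shell n (a b : R) : a <= b ->
  ((gap_weight n.+1 a)%:E <= (gap_weight n.+1 b)%:E + shell n a b a *+ n.+1)%E.
Proof.
move=> ab; rewrite -integral_sum_shell_integrand// -gap_weightE.
apply: ge0_le_integral => //.
- by move=> l _; rewrite lee_fin mulr_ge0 ?beta_weight_ge0 ?all_outside_ge0.
- exact: measurable_int (integrable_gap_integrand _ _).
- apply: emeasurable_funD; first exact: measurable_int (integrable_gap_integrand _ _).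
  apply: emeasurable_sum => i.
  by apply/measurable_EFinP; exact: measurable_shell_integrand.
move=> l _; rewrite sumEFin -EFinD lee_fin -sum_shell_integrand -mulrDr.
rewrite ler_wpM2l ?beta_weight_ge0//.
by apply: prod_indic_le => i; exact: le_lt_trans.
Qed.

(** Tuples with one entry in the shell and the others outside [[-b, b]] are lost, and
    [prod_indic_ge] counts each only once. *)
Lemma shell_le_gap_weight n (a b : R) : a <= b ->
  ((gap_weight n.+1 b)%:E + shell n a b b *+ n.+1 <= (gap_weight n.+1 a)%:E)%E.
Proof.
move=> ab; rewrite -integral_sum_shell_integrand// -gap_weightE.
apply: ge0_le_integral => //.
- move=> l _; rewrite adde_ge0//.
    by rewrite lee_fin mulr_ge0 ?beta_weight_ge0 ?all_outside_ge0.
  by apply: sume_ge0 => i _; rewrite lee_fin shell_integrand_ge0.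
- apply: emeasurable_funD; first exact: measurable_int (integrable_gap_integrand _ _).
  apply: emeasurable_sum => i.
  by apply/measurable_EFinP; exact: measurable_shell_integrand.
- exact: measurable_int (integrable_gap_integrand _ _).
move=> l _; rewrite sumEFin -EFinD lee_fin -sum_shell_integrand -mulrDr.
rewrite ler_wpM2l ?beta_weight_ge0//.
by apply: prod_indic_ge => i; exact: le_lt_trans.
Qed.

(** Since [0 <= a], the bands lie on opposite sides of 0 and at most one indicator is nonzero. *)
Lemma outside_band (a b x : R) : 0 <= a -> a <= b ->
  outside a x - outside b x = \1_`]a, b] x + \1_`[- b, - a[ x.
Proof.
move=> a0 ab; rewrite !indicE !mem_setE !in_itv/= /outside.
have [x0|x0] := ger0P x.
  have -> : (x < - a) = false.
    by apply/negbTE; rewrite -leNgt (le_trans _ x0)// oppr_le0.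
  rewrite andbF addr0.
  have [bx|bx] := ltP b x; last by rewrite andbT subr0.
  by rewrite (le_lt_trans ab bx) subrr.
have -> : (a < x) = false by apply/negbTE; rewrite -leNgt (le_trans (ltW x0)).
rewrite add0r ltrNr.
have [bx|bx] := ltP b (- x); last by rewrite lerNl bx subr0.
by rewrite ltrNr (le_lt_trans ab bx) lerNl leNgt bx subrr.
Qed.

(** Two levels, because the density near [e] and near [-e] is estimated separately. *)
Lemma integral_two_bands (a b k k' : R) : a <= b -> 0 <= k -> 0 <= k' ->
  (\int[leb]_(x in [set: RM]) (k * \1_`]a, b] x + k' * \1_`[- b, - a[ x)%:E)%E =
  ((k + k') * (b - a))%:E.
Proof.
move=> ab k0 k'0.
have m1 (A : set RM) (q : R) : measurable A -> 0 <= q ->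
    measurable_fun [set: RM] (fun x => (q * \1_A x)%:E).
  by move=> mA q0; apply/measurable_EFinP; apply: measurable_funM.
have I1 (A : set RM) (q : R) : measurable A -> 0 <= q ->
    (\int[leb]_(x in [set: RM]) (q * \1_A x)%:E)%E = (q%:E * leb A)%E.
  move=> mA q0; under eq_integral do rewrite EFinM.
  rewrite ge0_integralZl_EFin//.
    by rewrite integral_indic// setIT.
  exact/measurable_EFinP.
under eq_integral do rewrite EFinD.
rewrite ge0_integralD//; last 4 first.
- by move=> x _; rewrite lee_fin mulr_ge0.
- exact: m1.
- by move=> x _; rewrite lee_fin mulr_ge0.
- exact: m1.
rewrite !I1// !lebesgue_measure_itv/= !lte_fin ltrN2.
case: ltP => [_|ba].
  by rewrite -!EFinB -!EFinM -EFinD; congr EFin; ring.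
(* Here the length formula for intervals returns 0, which is [b - a] as [a = b]. *)
have -> : a = b by apply/eqP; rewrite eq_le ab.
by rewrite subrr !mule0 mulr0 adde0.
Qed.

Lemma shell_le n (a b c k k' : R) : 0 <= a -> a <= b -> 0 <= k -> 0 <= k' ->
  (forall x, a < x <= b -> edge_density n x c <= k) ->
  (forall x, - b <= x < - a -> edge_density n x c <= k') ->
  (shell n a b c <= ((k + k') * (b - a))%:E)%E.
Proof.
move=> a0 ab k0 k'0 kP k'P; rewrite -integral_two_bands//.
apply: ge0_le_integral => //.
- by move=> x _; rewrite lee_fin mulr_ge0 ?outside_anti ?edge_density_ge0.
- exact: measurable_shell.
- apply/measurable_EFinP.
  by apply: measurable_funD; exact: measurable_funM.
move=> x _; rewrite lee_fin outside_band// mulrDl lerD//.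
  rewrite indicE mem_setE in_itv/=.
  by case: (boolP (a < x <= b)) => [/kP|_]; rewrite ?mulr0 ?mul0r ?mulr1 ?mul1r.
rewrite indicE mem_setE in_itv/=.
by case: (boolP (- b <= x < - a)) => [/k'P|_]; rewrite ?mulr0 ?mul0r ?mulr1 ?mul1r.
Qed.

Lemma shell_ge n (a b c k k' : R) : 0 <= a -> a <= b -> 0 <= k -> 0 <= k' ->
  (forall x, a < x <= b -> k <= edge_density n x c) ->
  (forall x, - b <= x < - a -> k' <= edge_density n x c) ->
  (((k + k') * (b - a))%:E <= shell n a b c)%E.
Proof.
move=> a0 ab k0 k'0 kP k'P; rewrite -integral_two_bands//.
apply: ge0_le_integral => //.
- by move=> x _; rewrite lee_fin addr_ge0// mulr_ge0.
- apply/measurable_EFinP.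
  by apply: measurable_funD; exact: measurable_funM.
- exact: measurable_shell.
move=> x _; rewrite lee_fin outside_band// mulrDl lerD//.
  rewrite indicE mem_setE in_itv/=.
  by case: (boolP (a < x <= b)) => [/kP|_]; rewrite ?mulr0 ?mul0r ?mulr1 ?mul1r.
rewrite indicE mem_setE in_itv/=.
by case: (boolP (- b <= x < - a)) => [/k'P|_]; rewrite ?mulr0 ?mul0r ?mulr1 ?mul1r.
Qed.

End gap_weight.

(** Strict differentiability, with both endpoints moving, matches the two-point bounds on the gap
    integral. One endpoint is then fixed at [e]; as pairs are ordered, the sign of [h] decides
    which. *)
Lemma strict_is_derive (R : realType) (f : R -> R) (e D : R) :
  (forall eps, 0 < eps -> exists2 d, 0 < d & forall a b, a <= b ->
     `|a - e| < d -> `|b - e| < d ->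
     `|f b - f a - D * (b - a)| <= eps * (b - a)) ->
  is_derive e 1 f D.
Proof.
move=> fP.
have cvgD : h^-1 *: (f (h *: 1 + e) - f e) @[h --> 0^'] --> D.
  apply/cvgrPdist_le => eps eps0; have [d d0 dP] := fP _ eps0.
  near=> h.
  have h0 : h != 0 by near: h; exact: nbhs_dnbhs_neq.
  have hd : `|h| < d by near: h; exact: dnbhs0_lt.
  rewrite /GRing.scale/= mulr1.
  rewrite -[D](mulKf h0) -mulrBr normrM normfV ler_pdivrMl ?normr_gt0//.
  rewrite [leRHS]mulrC distrC.
  rewrite [h * D]mulrC; have [h_gt0|h_le0] := ltP 0 h.
    have := dP e (h + e); rewrite addrK subrr normr0 lerDr (ltW h_gt0) d0 hd.
    by move=> /(_ isT isT isT); rewrite -[h in leRHS](gtr0_norm h_gt0).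
  have := dP (h + e) e; rewrite addrK subrr normr0 gerDr h_le0 d0 hd.
  move=> /(_ isT isT isT); rewrite (ler0_norm h_le0) opprD addrCA subrr addr0.
  rewrite (_ : f e - _ - _ = - (f (h + e) - f e - D * h)); last by ring.
  by rewrite normrN; congr (`|f (_ + _) - _ - _| <= _); rewrite /GRing.scale/= mulr1.
apply: DeriveDef; first by apply/cvg_ex; exists D.
by rewrite /derive; apply/cvg_lim.
Unshelve. all: end_near. Qed.

(** * The derivative, its limit at 0 and the constants *)

Section gap_derivative.
Context {R : realType}.
Variable beta : R.
Hypothesis beta_gt0 : 0 < beta.
Local Notation RM := (measurableTypeR R).
Local Notation leb := (@lebesgue_measure R).
Local Notation edge_density := (edge_density beta).

(** The upper bound uses [c = a] and the lower one [c = b]. Each of the two bands errs by at most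
    [eta] per unit length, whence [2 * eta]. *)
Lemma gap_weight_bounds n (a b k k' eta : R) : 0 <= a -> a <= b ->
  0 <= k -> 0 <= k' -> 0 <= eta ->
  (forall x c, a <= x <= b -> a <= c <= b -> `|edge_density n x c - k| <= eta) ->
  (forall x c, - b <= x <= - a -> a <= c <= b ->
     `|edge_density n x c - k'| <= eta) ->
  `|gap_weight beta n.+1 b - gap_weight beta n.+1 a +
    n.+1%:R * (k + k') * (b - a)| <= n.+1%:R * (2 * eta) * (b - a).
Proof.
move=> a0 ab k0 k'0 eta0 kP k'P.
have aab : a <= a <= b by rewrite lexx ab.
have bab : a <= b <= b by rewrite ab lexx.
have ba : 0 <= b - a by rewrite subr_ge0.
have up : gap_weight beta n.+1 a <= gap_weight beta n.+1 b +
    n.+1%:R * ((k + eta + (k' + eta)) * (b - a)).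
  rewrite -lee_fin EFinD; apply: (le_trans (gap_weight_le_shell beta_gt0 n ab)).
  rewrite leeD2l// -mule_natl EFinM; apply: lee_wpmul2l; first by rewrite lee_fin.
  apply: shell_le; rewrite ?addr_ge0// => x /andP[h1 h2].
    have := kP x a; rewrite (ltW h1) h2 => /(_ isT aab).
    by rewrite ler_norml lerBlDl => /andP[].
  have := k'P x a; rewrite (ltW h2) h1 => /(_ isT aab).
  by rewrite ler_norml lerBlDl => /andP[].
(* [shell_ge] takes nonnegative levels, so [q - eta] is cut off at 0; the result still lies below
   the nonnegative density. *)
pose lo (q : R) := Num.max 0 (q - eta).
have lo0 q : 0 <= lo q by rewrite /lo le_max lexx.
have loP q : q - eta <= lo q by rewrite /lo le_max lexx orbT.
have dn : gap_weight beta n.+1 b + n.+1%:R * ((lo k + lo k') * (b - a)) <=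
    gap_weight beta n.+1 a.
  rewrite -lee_fin EFinD; apply: le_trans (shell_le_gap_weight beta_gt0 n ab).
  rewrite leeD2l// -mule_natl EFinM; apply: lee_wpmul2l; first by rewrite lee_fin.
  apply: shell_ge => // x /andP[h1 h2]; rewrite /lo ge_max edge_density_ge0/=.
    have := kP x b; rewrite (ltW h1) h2 => /(_ isT bab).
    by rewrite ler_norml lerBrDl => /andP[].
  have := k'P x b; rewrite (ltW h2) h1 => /(_ isT bab).
  by rewrite ler_norml lerBrDl => /andP[].
have : (k - eta + (k' - eta)) * (b - a) <= (lo k + lo k') * (b - a).
  by rewrite ler_wpM2r// lerD.
move=> /(ler_wpM2l (ler0n R n.+1)) lok.
rewrite ler_norml; apply/andP; split; lra.
Qed.

Definition edge_sum n e : R := edge_density n e e + edge_density n (- e) e.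

Lemma is_derive_gap_weight n (e : R) : 0 < e ->
  is_derive e 1 (gap_weight beta n.+1) (- n.+1%:R * edge_sum n e).
Proof.
move=> e0; apply: strict_is_derive => eps eps0.
(* Chosen so that [n.+1 * (2 * eta) = eps]. *)
pose eta := eps / (n.+1%:R * 2).
have eta0 : 0 < eta by rewrite divr_gt0.
have [d1 d10 d1P] := edge_density_near beta_gt0 n e e eta0.
have [d2 d20 d2P] := edge_density_near beta_gt0 n (- e) e eta0.
(* Including [e] in the minimum keeps [a] nonnegative. *)
exists (Num.min e (Num.min d1 d2)); first by rewrite !lt_min e0 d10.
move=> a b ab; rewrite !lt_min => /and3P[ae ad1 ad2] /and3P[be bd1 bd2].
have dist_le d x : `|a - e| < d -> `|b - e| < d -> a <= x <= b -> `|x - e| < d.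
  rewrite !ltr_distl => /andP[? _] /andP[_ ?] /andP[? ?]; lra.
have a0 : 0 <= a by move: ae; rewrite ltr_distl subrr => /andP[/ltW].
have H := gap_weight_bounds a0 ab (edge_density_ge0 beta n e e)
  (edge_density_ge0 beta n (- e) e) (ltW eta0).
have -> : eps * (b - a) = n.+1%:R * (2 * eta) * (b - a).
  by rewrite /eta; congr (_ * _); field; rewrite addrC natr1.
rewrite !mulNr opprK; apply: H => x c /andP[x1 x2] cab; apply: ltW.
  by apply: d1P; apply: dist_le; rewrite ?x1.
(* The distance from [x] to [-e] is that from [-x] to [e], and [-x] lies in [[a, b]]. *)
apply: d2P; last exact: dist_le.
rewrite opprK -normrN opprD; apply: (dist_le _ (- x)) => //.
by rewrite lerNr x2 lerNl x1.
Qed.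

Lemma edge_sum_cvg0 n : edge_sum n e @[e --> 0^'+] --> 2 * edge_density n 0 0.
Proof.
apply/cvgrPdist_le => eps eps0.
have eps2 : 0 < eps / 2 by rewrite divr_gt0.
(* Joint continuity at [(0, 0)] serves both [(e, e)] and [(-e, e)] with one radius. *)
have [d d0 dP] := edge_density_near beta_gt0 n 0 0 eps2.
near=> e.
have e0 : 0 < e by near: e; exact: nbhs_right_gt.
have ed : e < d by near: e; exact: nbhs_right_lt.
have h1 := dP e e; have h2 := dP (- e) e.
rewrite !subr0 normrN gtr0_norm// in h1 h2.
rewrite distrC /edge_sum mulr_natl mulr2n opprD addrACA.
rewrite (le_trans (ler_normD _ _))// [leRHS](splitr eps).
by apply: lerD; apply: ltW; [apply: h1|apply: h2].
Unshelve. all: end_near. Qed.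

(** The cut-off [all_outside 0] is 1 unless some entry is 0, hence almost everywhere; the slice at 0
    supplies the determinant factor. *)
Lemma expect_absdetE n :
  expect_absdet_powR beta n = beta_const beta n * edge_density n 0 0.
Proof.
rewrite /expect_absdet_powR /edge_density -RintegralZl//; last first.
  exact: integrable_edge_integrand.
congr (fine _).
rewrite (eq_integral (fun l => (beta_const beta n * beta_slice beta 0 l)%:E)).
  apply: ae_eq_integral => //.
  - apply/measurable_EFinP; apply: measurable_funM => //.
    exact: measurable_beta_slice.
  - apply/measurable_EFinP; apply: measurable_funM => //; apply: measurable_funM.
      exact: measurable_beta_slice.
    exact: measurable_all_outside.
  apply: filterS (tuple_measure_ae_neq n 0) => l l0 _.
  rewrite /all_outside big1 ?mulr1// => i _; rewrite /outside normr_gt0.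
  suff -> : tnth l i != 0 by [].
  by apply/eqP => li; apply: (l0 i); rewrite li normr0.
move=> l _; congr EFin.
by rewrite beta_densityE beta_slice0 mulrCA.
Qed.

(* If [beta_const beta n = 0] the quotient is the junk value 0, but then
   [beta_const beta n.+1] vanishes too: positivity of Gamma is not needed. *)
Lemma beta_constK n :
  beta_const beta n.+1 / beta_const beta n * beta_const beta n =
  beta_const beta n.+1.
Proof.
have [Cn0|Cn] := eqVneq (beta_const beta n) 0; last by rewrite divfK.
rewrite Cn0 mulr0; apply/esym/eqP; move/eqP: Cn0; rewrite /beta_const.
have pi2 : 0 < 2 * pi :> R by rewrite mulr_gt0 ?pi_gt0.
rewrite !mulf_eq0 !powR_eq0 !(gt_eqF beta_gt0) !(gt_eqF pi2)/=.
by rewrite [X in _ -> X == 0]big_nat_recr//= => /eqP ->; rewrite mul0r.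
Qed.

End gap_derivative.

Theorem theorem2 (R : realType) (beta : R) (n : nat)
    (beta_gt0 : 0 < beta) (n_ge2 : (2 <= n)%N) :
  (forall e : R, 0 < e -> derivable (gap_probability beta n) e 1) /\
  derive1 (gap_probability beta n) e @[e --> 0^'+] -->
    - 2 * n%:R * (beta_const beta n / beta_const beta n.-1)
      * expect_absdet_powR beta n.-1.
Proof.
case: n n_ge2 => [//|n] _.
have gapE : gap_probability beta n.+1 = beta_const beta n.+1 *: gap_weight beta n.+1.
  by apply/funext => e; rewrite gap_probabilityE.
have dgap (e : R) : 0 < e -> is_derive e 1 (gap_probability beta n.+1)
    (beta_const beta n.+1 * (- n.+1%:R * edge_sum beta n e)).
  by move=> /(is_derive_gap_weight beta_gt0 n) ?; rewrite gapE; exact: is_deriveZ.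
split=> [e /dgap[]//|].
rewrite expect_absdetE//=.
(* The constant inside the expectation cancels the denominator, by [beta_constK]. *)
have -> : - 2 * n.+1%:R * (beta_const beta n.+1 / beta_const beta n) *
    (beta_const beta n * edge_density beta n 0 0) =
    beta_const beta n.+1 * (- n.+1%:R * (2 * edge_density beta n 0 0)).
  by rewrite mulrA -[_ * (_ / _) * _]mulrA beta_constK//; ring.
have lim : beta_const beta n.+1 * (- n.+1%:R * edge_sum beta n e) @[e --> 0^'+] -->
    beta_const beta n.+1 * (- n.+1%:R * (2 * edge_density beta n 0 0)).
  apply: cvgM; first exact: cvg_cst.
  apply: cvgM; first exact: cvg_cst.
  exact: edge_sum_cvg0.
(* The derivative is given by the formula at [e > 0], which suffices for a right-hand limit. *)
apply: cvg_trans lim; apply: near_eq_cvg; near=> e.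
have e0 : 0 < e by near: e; exact: nbhs_right_gt.
by rewrite derive1E; have [_ ->] := dgap _ e0.
Unshelve. all: end_near. Qed.
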